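(* Let $k$ be a field, let $r\geq 1$ be an integer, and let $\hat H$ be a complete $k$-algebra augmented over $k^r$. Then $\hat H$ has exactly $r$ maximal right ideals. These are also maximal left ideals of $\hat H$.
   Context: All $k$-algebras are associative and unital with $k$ in the center; they need not be commutative. A $k$-algebra $H$ is augmented over $k^r$ if it comes with $k$-algebra homomorphisms $\rho:k^r\to H$ and $\pi:H\to k^r$ such that $\pi\circ\rho=\mathrm{id}_{k^r}$ (so $\pi$ is surjective). Put $\mathfrak m=\ker\pi$, a two-sided ideal. The $\mathfrak m$-adic completion of $H$ is $\hat H=\varprojlim_{n} H/\mathfrak m^n$. A $k$-algebra $S$ augmented over $k^r$ is called complete if the natural map $S\to\hat S$ to its completion with respect to the kernel of its augmentation is an isomorphism. *)

(* Defs.v *)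
From HB Require Import structures.
From mathcomp Require Import all_boot all_algebra.
From mathcomp Require Import boolp classical_sets functions cardinality.

Set Implicit Arguments.
Unset Strict Implicit.
Unset Printing Implicit Defensive.

Import GRing.Theory.
Local Open Scope ring_scope.
Local Open Scope quotient_scope.
Local Open Scope classical_set_scope.

Section MaximalIdeals.
Context {R : pzRingType}.
Implicit Types I J : set R.

Definition right_ideal I :=
  [/\ I 0, forall x y, I x -> I y -> I (x - y) & forall x a, I x -> I (x * a)].

Definition left_ideal I :=
  [/\ I 0, forall x y, I x -> I y -> I (x - y) & forall x a, I x -> I (a * x)].

Definition maximal_right_ideal I :=
  [/\ right_ideal I, I <> setT &
      forall J, right_ideal J -> I `<=` J -> J = I \/ J = setT].

Definition maximal_left_ideal I :=
  [/\ left_ideal I, I <> setT &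
      forall J, left_ideal J -> I `<=` J -> J = I \/ J = setT].

End MaximalIdeals.

(* The library only divides commutative rings by (proper) ideals, so two-sided
   ideals of arbitrary rings, possibly equal to the whole ring, and their
   quotients are set up here on top of the quotient of a zmodType. *)
HB.mixin Record isTwoSided (R : pzRingType) (S : R -> bool) := {
  two_sidedMl : forall a, {in S, forall u, a * u \in S};
  two_sidedMr : forall a, {in S, forall u, u * a \in S}
}.

#[short(type="two_sided_ideal")]
HB.structure Definition TwoSidedIdeal (R : pzRingType) :=
  {S of GRing.ZmodClosed R S & isTwoSided R S}.

Section QuotientAlgebra.
Context {k : fieldType} {H : algType k}.
Variable I : two_sided_ideal H.

Definition quot_alg : Type := Quotient.quot I.

HB.instance Definition _ := GRing.Zmodule.copy quot_alg (Quotient.quot I).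

Definition to_quot (x : H) : quot_alg := \pi_(Quotient.quot I) x.
Definition of_quot (u : quot_alg) : H := @repr H (Quotient.quot I) u.

Lemma of_quotK : cancel of_quot to_quot.
Proof. by move=> u; exact: (@reprK _ (Quotient.quot I)). Qed.

Lemma eq_to_quot x y : to_quot x = to_quot y <-> x - y \in I.
Proof.
rewrite (Quotient.idealrBE I) /to_quot; split=> [->|/eqP //]; exact: eqxx.
Qed.

Lemma of_quotP x : of_quot (to_quot x) - x \in I.
Proof. by apply/eq_to_quot; rewrite of_quotK. Qed.

Lemma to_quotB : {morph to_quot : x y / x - y}.
Proof. exact: (raddfB (\pi_(Quotient.quot I))). Qed.

Lemma to_quotD : {morph to_quot : x y / x + y}.
Proof. exact: (raddfD (\pi_(Quotient.quot I))). Qed.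

Definition quot_one : quot_alg := to_quot 1.
Definition quot_mul (u v : quot_alg) : quot_alg :=
  to_quot (of_quot u * of_quot v).
Definition quot_scale (a : k) (u : quot_alg) : quot_alg :=
  to_quot (a *: of_quot u).

Lemma to_quotM : {morph to_quot : x y / x * y >-> quot_mul x y}.
Proof.
move=> x y; apply/esym/eq_to_quot.
set x' := of_quot _; set y' := of_quot _.
have -> : x' * y' - x * y = (x' - x) * y' + x * (y' - y).
  by rewrite mulrBl mulrBr addrA subrK.
by apply: rpredD; [apply: two_sidedMr | apply: two_sidedMl]; exact: of_quotP.
Qed.

Lemma to_quotZ a x : to_quot (a *: x) = quot_scale a (to_quot x).
Proof.
apply/esym/eq_to_quot; rewrite -scalerBr -mulr_algl.
by apply: two_sidedMl; exact: of_quotP.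
Qed.

Lemma quot_mulA : associative quot_mul.
Proof.
move=> u v w; rewrite -(of_quotK u) -(of_quotK v) -(of_quotK w).
by rewrite -!to_quotM mulrA.
Qed.

Lemma quot_mul1l : left_id quot_one quot_mul.
Proof. by move=> u; rewrite -(of_quotK u) -to_quotM mul1r. Qed.

Lemma quot_mul1r : right_id quot_one quot_mul.
Proof. by move=> u; rewrite -(of_quotK u) -to_quotM mulr1. Qed.

Lemma quot_mulDl : left_distributive quot_mul +%R.
Proof.
move=> u v w; rewrite -(of_quotK u) -(of_quotK v) -(of_quotK w).
by rewrite -to_quotD -!to_quotM -to_quotD mulrDl.
Qed.

Lemma quot_mulDr : right_distributive quot_mul +%R.
Proof.
move=> u v w; rewrite -(of_quotK u) -(of_quotK v) -(of_quotK w).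
by rewrite -to_quotD -!to_quotM -to_quotD mulrDr.
Qed.

HB.instance Definition _ := GRing.Zmodule_isPzRing.Build quot_alg
  quot_mulA quot_mul1l quot_mul1r quot_mulDl quot_mulDr.

Lemma quot_scaleA a b u : quot_scale a (quot_scale b u) = quot_scale (a * b) u.
Proof. by rewrite -(of_quotK u) -!to_quotZ scalerA. Qed.

Lemma quot_scale1 : left_id 1 quot_scale.
Proof. by move=> u; rewrite -(of_quotK u) -to_quotZ scale1r. Qed.

Lemma quot_scaleDr : right_distributive quot_scale +%R.
Proof.
move=> a u v; rewrite -(of_quotK u) -(of_quotK v).
by rewrite -to_quotD -!to_quotZ -to_quotD scalerDr.
Qed.

Lemma quot_scaleDl u : {morph quot_scale^~ u : a b / a + b}.
Proof.
by move=> a b; rewrite /= -(of_quotK u) -!to_quotZ -to_quotD scalerDl.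
Qed.

HB.instance Definition _ := GRing.Zmodule_isLmodule.Build k quot_alg
  quot_scaleA quot_scale1 quot_scaleDr quot_scaleDl.

HB.instance Definition _ := GRing.isZmodMorphism.Build H quot_alg to_quot
  to_quotB.
HB.instance Definition _ := GRing.isMonoidMorphism.Build H quot_alg to_quot
  (erefl, to_quotM).
HB.instance Definition _ := GRing.isScalable.Build k H quot_alg *:%R to_quot
  to_quotZ.

End QuotientAlgebra.

Section AdicCompletion.
Context {k : fieldType} {H : algType k}.
Variable m : two_sided_ideal H.

(* m^0 is the whole ring and m^(n+1) the additive span of the products x * y
   with x in m^n and y in m. *)
Fixpoint ideal_pow (n : nat) : set H :=
  if n is n'.+1 then
    [set z | exists s : seq (H * H),
       (forall p, p \in s -> ideal_pow n' p.1 /\ p.2 \in m) /\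
       z = \sum_(p <- s) p.1 * p.2]
  else setT.

Definition ideal_powb (n : nat) (x : H) : bool := `[< ideal_pow n x >].

Lemma ideal_powN n x : ideal_pow n x -> ideal_pow n (- x).
Proof.
elim: n x => [//|n IHn] x /= [s [sP ->]].
exists [seq (- p.1, p.2) | p <- s]; split.
  by move=> _ /mapP[p /sP[p1 p2] ->]; split=> //=; exact: IHn.
by rewrite big_map -sumrN; apply: eq_bigr => p _; rewrite mulNr.
Qed.

Lemma ideal_powMl n a x : ideal_pow n x -> ideal_pow n (a * x).
Proof.
elim: n x => [//|n IHn] x /= [s [sP ->]].
exists [seq (a * p.1, p.2) | p <- s]; split.
  by move=> _ /mapP[p /sP[p1 p2] ->]; split=> //=; exact: IHn.
by rewrite big_map mulr_sumr; apply: eq_bigr => p _; rewrite mulrA.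
Qed.

Lemma ideal_powMr n a x : ideal_pow n x -> ideal_pow n (x * a).
Proof.
case: n x => [//|n] x /= [s [sP ->]].
exists [seq (p.1, p.2 * a) | p <- s]; split.
  by move=> _ /mapP[p /sP[p1 p2] ->]; split=> //=; exact: two_sidedMr.
by rewrite big_map mulr_suml; apply: eq_bigr => p _; rewrite mulrA.
Qed.

Lemma ideal_powb_zmod n : zmod_closed (ideal_powb n).
Proof.
split=> [|x y /asboolP xI /asboolP/ideal_powN yI]; apply/asboolP.
  by case: n => [//|n]; exists [::]; rewrite big_nil.
case: n x y xI yI => [//|n] x y /= [s [sP ->]] [t [tP ->]].
exists (s ++ t); split; last by rewrite big_cat.
by move=> p; rewrite mem_cat => /orP[/sP|/tP].
Qed.

Lemma ideal_powbMl n a : {in ideal_powb n, forall x, a * x \in ideal_powb n}.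
Proof. by move=> x /asboolP xI; apply/asboolP; exact: ideal_powMl. Qed.

Lemma ideal_powbMr n a : {in ideal_powb n, forall x, x * a \in ideal_powb n}.
Proof. by move=> x /asboolP xI; apply/asboolP; exact: ideal_powMr. Qed.

HB.instance Definition _ n := GRing.isZmodClosed.Build H (ideal_powb n)
  (ideal_powb_zmod n).
HB.instance Definition _ n := isTwoSided.Build H (ideal_powb n)
  (@ideal_powbMl n) (@ideal_powbMr n).

Definition adic_ideal (n : nat) : two_sided_ideal H :=
  TwoSidedIdeal.clone H (ideal_powb n) _.

Definition adic_quot (n : nat) := quot_alg (adic_ideal n).

(* Computed on representatives; adic_projE shows that it is the canonical
   projection. *)
Definition adic_proj (n : nat) (u : adic_quot n.+1) : adic_quot n :=
  to_quot (adic_ideal n) (of_quot u).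

Lemma ideal_powS n x : ideal_pow n.+1 x -> ideal_pow n x.
Proof.
move=> [s [sP ->]]; apply/asboolP; rewrite big_seq.
suff : \sum_(p <- s | p \in s) p.1 * p.2 \in adic_ideal n by [].
apply: rpred_sum => p ps.
by apply/asboolP; apply: ideal_powMr; have [] := sP _ ps.
Qed.

Lemma adic_projE n x :
  adic_proj (to_quot (adic_ideal n.+1) x) = to_quot (adic_ideal n) x.
Proof.
apply/eq_to_quot; apply/asboolP/ideal_powS/asboolP.
exact: (of_quotP (adic_ideal n.+1)).
Qed.

Lemma adic_projB n : zmod_morphism (@adic_proj n).
Proof.
move=> u v; rewrite -(of_quotK u) -(of_quotK v).
by rewrite -raddfB !adic_projE raddfB.
Qed.
HB.instance Definition _ n := GRing.isZmodMorphism.Build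
  (adic_quot n.+1) (adic_quot n) (@adic_proj n) (@adic_projB n).

Lemma adic_projM n : monoid_morphism (@adic_proj n).
Proof.
split=> [|u v]; first exact: adic_projE.
rewrite -(of_quotK u) -(of_quotK v).
by rewrite -rmorphM !adic_projE rmorphM.
Qed.
HB.instance Definition _ n := GRing.isMonoidMorphism.Build
  (adic_quot n.+1) (adic_quot n) (@adic_proj n) (@adic_projM n).

Lemma adic_projZ n : scalable (@adic_proj n).
Proof. by move=> a u; rewrite -(of_quotK u) -linearZ !adic_projE linearZ. Qed.
HB.instance Definition _ n := GRing.isScalable.Build k
  (adic_quot n.+1) (adic_quot n) *:%R (@adic_proj n) (@adic_projZ n).

Record completion : Type := Completion {
  compl_val :> forall n, adic_quot n;
  compl_valP : forall n, adic_proj (compl_val n.+1) = compl_val n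
}.

Lemma completionP (x y : completion) : (forall n, x n = y n) -> x = y.
Proof.
case: x y => [x xP] [y yP] /= xy.
have {}xy : x = y by exact: functional_extensionality_dep.
by subst y; congr Completion; exact: Prop_irrelevance.
Qed.

HB.instance Definition _ := gen_eqMixin completion.
HB.instance Definition _ := gen_choiceMixin completion.

Program Definition compl_zero := @Completion (fun=> 0) _.
Next Obligation. by rewrite raddf0. Qed.
Program Definition compl_opp (x : completion) := @Completion (fun n => - x n) _.
Next Obligation. by rewrite raddfN /= compl_valP. Qed.
Program Definition compl_add (x y : completion) :=
  @Completion (fun n => x n + y n) _.
Next Obligation. by rewrite raddfD /= !compl_valP. Qed.
Program Definition compl_one := @Completion (fun=> 1) _.
Next Obligation. by rewrite rmorph1. Qed.
Program Definition compl_mul (x y : completion) :=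
  @Completion (fun n => x n * y n) _.
Next Obligation. by rewrite rmorphM /= !compl_valP. Qed.
Program Definition compl_scale (a : k) (x : completion) :=
  @Completion (fun n => a *: x n) _.
Next Obligation. by rewrite linearZ /= compl_valP. Qed.

Lemma compl_addA : associative compl_add.
Proof. by move=> x y z; apply: completionP => n; exact: addrA. Qed.
Lemma compl_addC : commutative compl_add.
Proof. by move=> x y; apply: completionP => n; exact: addrC. Qed.
Lemma compl_add0 : left_id compl_zero compl_add.
Proof. by move=> x; apply: completionP => n; exact: add0r. Qed.
Lemma compl_addN : left_inverse compl_zero compl_opp compl_add.
Proof. by move=> x; apply: completionP => n; exact: addNr. Qed.

HB.instance Definition _ := GRing.isZmodule.Build completion
  compl_addA compl_addC compl_add0 compl_addN.

Lemma compl_mulA : associative compl_mul.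
Proof. by move=> x y z; apply: completionP => n; exact: mulrA. Qed.
Lemma compl_mul1l : left_id compl_one compl_mul.
Proof. by move=> x; apply: completionP => n; exact: mul1r. Qed.
Lemma compl_mul1r : right_id compl_one compl_mul.
Proof. by move=> x; apply: completionP => n; exact: mulr1. Qed.
Lemma compl_mulDl : left_distributive compl_mul +%R.
Proof. by move=> x y z; apply: completionP => n; exact: mulrDl. Qed.
Lemma compl_mulDr : right_distributive compl_mul +%R.
Proof. by move=> x y z; apply: completionP => n; exact: mulrDr. Qed.

HB.instance Definition _ := GRing.Zmodule_isPzRing.Build completion
  compl_mulA compl_mul1l compl_mul1r compl_mulDl compl_mulDr.

Lemma compl_scaleA a b x :
  compl_scale a (compl_scale b x) = compl_scale (a * b) x.
Proof. by apply: completionP => n; exact: scalerA. Qed.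
Lemma compl_scale1 : left_id 1 compl_scale.
Proof. by move=> x; apply: completionP => n; exact: scale1r. Qed.
Lemma compl_scaleDr : right_distributive compl_scale +%R.
Proof. by move=> a x y; apply: completionP => n; exact: scalerDr. Qed.
Lemma compl_scaleDl x : {morph compl_scale^~ x : a b / a + b}.
Proof. by move=> a b; apply: completionP => n; exact: scalerDl. Qed.

HB.instance Definition _ := GRing.Zmodule_isLmodule.Build k completion
  compl_scaleA compl_scale1 compl_scaleDr compl_scaleDl.

Program Definition to_completion (x : H) :=
  @Completion (fun n => to_quot (adic_ideal n) x) _.
Next Obligation. exact: adic_projE. Qed.

Lemma to_completionB : zmod_morphism to_completion.
Proof. by move=> x y; apply: completionP => n; exact: raddfB. Qed.
HB.instance Definition _ := GRing.isZmodMorphism.Build H completion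
  to_completion to_completionB.

Lemma to_completionM : monoid_morphism to_completion.
Proof.
by split=> [|x y]; apply: completionP => n; rewrite /= ?rmorph1 ?rmorphM.
Qed.
HB.instance Definition _ := GRing.isMonoidMorphism.Build H completion
  to_completion to_completionM.

Lemma to_completionZ : scalable to_completion.
Proof. by move=> a x; apply: completionP => n; exact: linearZ. Qed.
HB.instance Definition _ := GRing.isScalable.Build k H completion *:%R
  to_completion to_completionZ.

End AdicCompletion.

(* k^r is {ffun 'I_r -> k^o} with pointwise operations.  For variable r it is a
   pzRingType and an lmodType but not an algType (r = 0 gives the zero ring),
   so k-algebra maps to and from it are scalable ring morphisms. *)
Record augmentation (k : fieldType) (r : nat) (H : algType k) := Augmentation {
  aug_unit : {rmorphism {ffun 'I_r -> k^o} -> H};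
  aug_unitZ : scalable aug_unit;
  aug_map : {rmorphism H -> {ffun 'I_r -> k^o}};
  aug_mapZ : scalable aug_map;
  aug_unitK : cancel aug_unit aug_map
}.

Section Complete.
Context {k : fieldType} {r : nat} {H : algType k}.
Variable aug : augmentation r H.

Definition aug_ker (x : H) : bool := aug_map aug x == 0.

Lemma aug_ker_zmod : zmod_closed aug_ker.
Proof.
split=> [|x y /eqP x0 /eqP y0]; apply/eqP; first by rewrite raddf0.
by rewrite raddfB /= x0 y0 subr0.
Qed.
HB.instance Definition _ := GRing.isZmodClosed.Build H aug_ker aug_ker_zmod.

Lemma aug_kerMl a : {in aug_ker, forall x, a * x \in aug_ker}.
Proof. by move=> x /eqP x0; apply/eqP; rewrite rmorphM /= x0 mulr0. Qed.
Lemma aug_kerMr a : {in aug_ker, forall x, x * a \in aug_ker}.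
Proof. by move=> x /eqP x0; apply/eqP; rewrite rmorphM /= x0 mul0r. Qed.
HB.instance Definition _ := isTwoSided.Build H aug_ker aug_kerMl aug_kerMr.

Definition aug_ideal : two_sided_ideal H := TwoSidedIdeal.clone H aug_ker _.

(* to_completion is a k-algebra morphism, so it is an isomorphism of k-algebras
   exactly when it is bijective. *)
Definition complete : Prop := bijective (to_completion aug_ideal).

End Complete.

(* Main.v *)
(** An element [x] of the augmentation ideal [m] has [1 - x] right invertible:
    by completeness the geometric series [1 + x + x^2 + ...] converges.  If a
    right ideal [I] lies in none of the kernels [M_i] of the [r] coordinates of
    the augmentation, a combination of elements of [I] lies in [1 + m], so that
    [I] is the whole ring.  Hence every proper right ideal lies in some [M_i],
    and the [M_i], which are two-sided with quotient [k], are exactly the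
    maximal right ideals. *)
Require Import Defs.
From mathcomp Require Import all_boot all_algebra.
From mathcomp Require Import boolp classical_sets functions cardinality.
Local Open Scope classical_set_scope.
Local Open Scope card_scope.

Set Implicit Arguments.
Unset Strict Implicit.
Unset Printing Implicit Defensive.

Import GRing.Theory.
Local Open Scope ring_scope.

Section RightIdeals.
Context {R : pzRingType}.
Implicit Types I : set R.

Lemma right_idealD I x y : right_ideal I -> I x -> I y -> I (x + y).
Proof.
case=> I0 IB _ Ix Iy; have -> : x + y = x - (0 - y) by rewrite sub0r opprK.
by apply: (IB _ _ Ix); exact: IB.
Qed.

Lemma right_ideal_sum I (T : Type) (s : seq T) (F : T -> R) :
  right_ideal I -> (forall t, I (F t)) -> I (\sum_(t <- s) F t).
Proof.
move=> rI IF; elim/big_ind: _ => // [|x y]; first by case: rI.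
exact: right_idealD.
Qed.

Lemma right_ideal_setT I x y : right_ideal I -> I x -> x * y = 1 -> I = setT.
Proof.
move=> [_ _ IM] Ix xy1; apply/seteqP; split=> // z _.
by rewrite -[z]mul1r -xy1 -mulrA; exact: IM.
Qed.

End RightIdeals.

Section AdicGeometricSeries.
Context {k : fieldType} {H : algType k}.
Variable m : two_sided_ideal H.

Lemma ideal_powX n (x : H) : x \in m -> ideal_pow m n (x ^+ n).
Proof.
move=> xm; elim: n => [//|n IHn]; exists [:: (x ^+ n, x)].
by split=> [p|]; rewrite ?big_seq1 ?exprSr // inE => /eqP ->.
Qed.

Lemma to_quotX0 n (x : H) : x \in m -> to_quot (adic_ideal m n) (x ^+ n) = 0.
Proof.
move=> xm; rewrite -(raddf0 (to_quot (adic_ideal m n))).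
by apply/eq_to_quot; rewrite subr0; apply/asboolP/ideal_powX.
Qed.

(** Consecutive partial sums differ by [x ^+ n], which vanishes modulo [m^n]. Hence the partial sums
    form a compatible family, that is, a point of the completion. *)
Lemma geometric_proj (x : H) n : x \in m ->
  adic_proj (to_quot (adic_ideal m n.+1) (\sum_(i < n.+1) x ^+ i)) =
  to_quot (adic_ideal m n) (\sum_(i < n) x ^+ i).
Proof.
by move=> xm; rewrite adic_projE big_ord_recr raddfD /= to_quotX0 // addr0.
Qed.

Lemma complete_rinv (x : H) : bijective (to_completion m) -> x \in m ->
  exists y, (1 - x) * y = 1.
Proof.
move=> [g toK gK] xm.
(* [s] is the geometric series, cut after [n] terms at level [n]; its preimage [g s] is the inverse
   sought, which injectivity of the completion map lets one check level by level. *)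
pose s := Completion (fun n => geometric_proj n xm).
exists (g s); apply: (can_inj toK); rewrite rmorphM /= gK.
apply: completionP => n /=.
(* The product telescopes to [1 - x ^+ n], which is [1] modulo [m^n]. *)
have -> : to_quot (adic_ideal m n) 1 =
    to_quot (adic_ideal m n) ((1 - x) * \sum_(i < n) x ^+ i).
  rewrite -[1 - x]opprB mulNr -subrX1 opprB raddfB /=.
  by rewrite to_quotX0 // subr0.
by rewrite rmorphM.
Qed.

End AdicGeometricSeries.

Section CoordinateIdeals.
Context {k : fieldType} {r : nat} {H : algType k}.
Variable aug : augmentation r H.

Definition coord_ideal (i : 'I_r) : set H := [set x | aug_map aug x i = 0].

(** The lift to [H] of [c] times the [i]-th primitive idempotent of [k^r]. *)
Definition coord_unit (i : 'I_r) (c : k) : H :=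
  aug_unit aug [ffun j => if j == i then c else 0].

Lemma aug_map_coord_unit i c j :
  aug_map aug (coord_unit i c) j = if j == i then c else 0.
Proof. by rewrite aug_unitK ffunE. Qed.

Lemma aug_mapM x y i :
  aug_map aug (x * y) i = aug_map aug x i * aug_map aug y i.
Proof. by rewrite rmorphM /= ffunE. Qed.

Lemma aug_mapB x y i :
  aug_map aug (x - y) i = aug_map aug x i - aug_map aug y i.
Proof. by rewrite raddfB /= !ffunE. Qed.

Lemma aug_map1 i : aug_map aug 1 i = 1.
Proof. by rewrite rmorph1 ffunE. Qed.

Lemma coord_ideal_right i : right_ideal (coord_ideal i).
Proof.
split=> [|x y x0 y0|x a x0]; rewrite /coord_ideal /=.
- by rewrite raddf0 ffunE.
- by rewrite aug_mapB x0 y0 subr0.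
- by rewrite aug_mapM x0 mul0r.
Qed.

Lemma coord_ideal_left i : left_ideal (coord_ideal i).
Proof.
have [I0 IB _] := coord_ideal_right i; split=> // x a x0.
by rewrite /coord_ideal /= aug_mapM x0 mulr0.
Qed.

Lemma coord_ideal_proper i : coord_ideal i <> setT.
Proof.
move=> IT; have : coord_ideal i 1 by rewrite IT.
by rewrite /coord_ideal /= aug_map1 => /eqP; rewrite oner_eq0.
Qed.

(** The quotient by [coord_ideal i] is the field [k]. The third hypothesis only asks that the [i]-th
    coordinates of [J] can be rescaled, so that left and right ideals are treated at once. *)
Lemma coord_ideal_maximal (J : set H) i :
  J 0 -> (forall x y, J x -> J y -> J (x - y)) ->
  (forall x c, J x ->
     exists2 y, J y & aug_map aug y i = aug_map aug x i * c) ->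
  coord_ideal i `<=` J -> J = coord_ideal i \/ J = setT.
Proof.
move=> J0 JB Jscale IJ.
have [JI|/existsNP[x /not_implyP[Jx x0]]] :=
  pselect (forall x, J x -> coord_ideal i x).
  by left; apply/seteqP.
right; apply/seteqP; split=> // z _.
(* The factor gives [y] the same [i]-th coordinate as [z], so [y - z] lies in [coord_ideal i], hence
   in [J]. *)
have [y Jy yE] := Jscale x ((aug_map aug x i)^-1 * aug_map aug z i) Jx.
rewrite -[z](subKr y); apply: (JB _ _ Jy); apply: IJ.
rewrite /coord_ideal /= aug_mapB yE mulrA mulfV ?mul1r ?subrr //.
exact/eqP.
Qed.

Lemma coord_ideal_maximal_right i : maximal_right_ideal (coord_ideal i).
Proof.
split; [exact: coord_ideal_right | exact: coord_ideal_proper |].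
move=> J [J0 JB JM]; apply: coord_ideal_maximal => // x c Jx.
exists (x * coord_unit i c); first exact: JM.
by rewrite aug_mapM aug_map_coord_unit eqxx.
Qed.

Lemma coord_ideal_maximal_left i : maximal_left_ideal (coord_ideal i).
Proof.
split; [exact: coord_ideal_left | exact: coord_ideal_proper |].
move=> J [J0 JB JM]; apply: coord_ideal_maximal => // x c Jx.
exists (coord_unit i c * x); first exact: JM.
by rewrite aug_mapM aug_map_coord_unit eqxx mulrC.
Qed.

(** The lift of the [j]-th idempotent separates: it lies in every [coord_ideal i] with [i] other
    than [j], but not in [coord_ideal j]. *)
Lemma coord_ideal_inj : injective coord_ideal.
Proof.
move=> i j ij; have [//|/negbTE nij] := eqVneq i j.
have : coord_ideal i (coord_unit j 1).
  by rewrite /coord_ideal /= aug_map_coord_unit nij.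
rewrite ij /coord_ideal /= aug_map_coord_unit eqxx => /eqP.
by rewrite oner_eq0.
Qed.

Hypothesis cH : complete aug.

Lemma proper_right_ideal_sub (I : set H) : right_ideal I -> I <> setT ->
  exists i, I `<=` coord_ideal i.
Proof.
move=> rI; apply: contra_notP => /forallNP nI.
have /choice[x xP] i : exists x, I x /\ aug_map aug x i != 0.
  by have /existsNP[x /not_implyP[Ix /eqP x0]] := nI i; exists x.
(* The [i]-th summand maps to the [i]-th idempotent of [k^r], so [s] maps to [1]; multiplying on the
   right keeps it in [I]. *)
pose s := \sum_i x i * coord_unit i (aug_map aug (x i) i)^-1.
have Is : I s.
  apply: right_ideal_sum => // i; case: rI => _ _; apply.
  by have [] := xP i.
have s1 : 1 - s \in aug_ideal aug.
  apply/eqP/ffunP => j; rewrite aug_mapB aug_map1 raddf_sum /= sum_ffunE ffunE.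
  rewrite (bigD1 j) //= big1 => [|i /negbTE ij].
    rewrite addr0 aug_mapM aug_map_coord_unit eqxx mulfV ?subrr //.
    by have [] := xP j.
  by rewrite aug_mapM aug_map_coord_unit eq_sym ij mulr0.
(* As [1 - (1 - s) = s], the geometric series in [1 - s] gives a right inverse of [s], an element of
   [I]. *)
have [y] := complete_rinv cH s1; rewrite subKr.
exact: right_ideal_setT.
Qed.

Lemma maximal_right_idealE :
  [set I | maximal_right_ideal I] = range coord_ideal.
Proof.
apply/seteqP; split=> [I [rI IT Imax]|_ [i _ <-]].
  have [i Ii] := proper_right_ideal_sub rI IT.
  exists i => //; have [//|] := Imax _ (coord_ideal_right i) Ii.
  by move=> /coord_ideal_proper.
exact: coord_ideal_maximal_right.
Qed.

End CoordinateIdeals.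

Theorem proposition1 (k : fieldType) (r : nat) (H : algType k)
    (aug : augmentation r H) :
  (1 <= r)%N -> complete aug ->
  ([set I : set H | maximal_right_ideal I] #= `I_r) /\
  (forall I : set H, maximal_right_ideal I -> maximal_left_ideal I).
Proof.
move=> _ cH; have E := maximal_right_idealE cH; split=> [|I].
  rewrite E; apply: card_eq_trans (inj_card_eq _) _.
    by move=> i j _ _; exact: coord_ideal_inj.
  by rewrite card_eq_sym; exact: card_II.
(* By the classification [I] is some [coord_ideal i], which is maximal on both sides. *)
rewrite -[maximal_right_ideal I]/([set J | maximal_right_ideal J] I) E.
by move=> [i _ <-]; exact: coord_ideal_maximal_left.
Qed.
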